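(* (1) Let $Q\in\mathbb{Z}[X]$ be a monic polynomial. Then every real root of $Q$ is either an integer or an irrational number. (2) Let $b>1$ be an integer and let $Q\in\mathbb{D}_b[X]$ be a polynomial whose coefficient of $X^{\deg(Q)}$ is equal to $1$. Then every real root of $Q$ is either an element of $\mathbb{D}_b$ or an irrational number.
   Context: For an integer $b>1$, $\mathbb{D}_b$ denotes the ring of $b$-decimal numbers, i.e. the set of all rational numbers that can be written $u\cdot b^e$ with $u\in\mathbb{Z}$ and $e\in\mathbb{Z}$. *)

(* Defs.v *)
From HB Require Import structures.
From mathcomp Require Import all_boot all_order all_algebra.
From mathcomp Require Import boolp classical_sets reals.

Set Implicit Arguments.
Unset Strict Implicit.
Unset Printing Implicit Defensive.

Import Order.TTheory GRing.Theory Num.Theory.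
Local Open Scope ring_scope.

(* The ring D_b. The exponent e ranges over int, so negative powers of b are
   included; membership is turned into a boolean classically, so that
   D_b[X] is [polyOver (bdecimal b)]. *)
Definition bdecimal (b : int) : {pred rat} :=
  fun x => `[< exists u e : int, x = u%:~R * b%:~R ^ e >].

(* Main.v *)
Require Import Defs.
From mathcomp Require Import all_boot all_order all_algebra.
From mathcomp Require Import boolp classical_sets reals.

Import Order.TTheory GRing.Theory Num.Theory.
Local Open Scope ring_scope.

(* Both parts are the rational root theorem: the denominator of a rational root
   of an integer polynomial divides its leading coefficient. That coefficient
   is 1 in the first part; in the second one, clearing the denominators of a
   monic polynomial over D_b by a power of b makes it this power of b. *)

(** Write [x] as p/q in lowest terms and let n be the degree. Multiplying P(x) = 0 by q^n gives an
    integer identity whose terms are all multiples of q, except perhaps the leading one. Hence q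
    divides the leading coefficient times p^n, and q is coprime to p. *)
Lemma dvd_denq_lead_coef (P : {poly int}) (x : rat) :
  root (map_poly intr P) x -> (denq x %| lead_coef P)%Z.
Proof.
set p := numq x; set q := denq x.
case Dn: (size P) => [|n].
  by move/eqP: Dn; rewrite size_poly_eq0 => /eqP ->; rewrite lead_coef0 dvdz0.
rewrite /root (@horner_coef_wide _ n.+1); last first.
  by rewrite -Dn size_poly.
move=> /eqP Px0.
have eqP0 : \sum_(i < n.+1) P`_i * p ^+ i * q ^+ (n - i) = 0.
  apply/eqP; rewrite -(intr_eq0 rat) rmorph_sum /=; apply/eqP.
  rewrite -[RHS](mul0r (q%:~R ^+ n)) -[in RHS]Px0 mulr_suml.
  apply: eq_bigr => i _; rewrite coef_map /= !rmorphM /= !rmorphXn /= numqE.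
  (* Split q^n as q^i q^(n - i): the first factor turns x^i into p^i. *)
  rewrite -[X in _ = _ * _ ^+ X](subnKC (ltn_ord i : (i <= n)%N)).
  by rewrite exprD exprMn !mulrA.
move: eqP0; rewrite big_ord_recr /= subnn expr0 mulr1 => /eqP.
rewrite addrC addr_eq0 => /eqP lead_eq.
have : (q %| P`_n * p ^+ n)%Z.
  rewrite lead_eq rpredN rpred_sum // => i _.
  by apply: dvdz_mull; apply: dvdz_exp => //; rewrite subn_gt0.
rewrite Gauss_dvdzl ?lead_coefE ?Dn //.
by apply: coprimezXr; rewrite coprimez_sym coprimezE coprime_num_den.
Qed.

Lemma bdecimal_mulX_int (b : int) (x : rat) : b != 0 -> x \in bdecimal b ->
  exists n : nat, x * b%:~R ^+ n \is a Num.int.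
Proof.
move=> b0 /asboolP [u [e ->]].
have bq0 : b%:~R != 0 :> rat by rewrite intr_eq0.
case: e => n.
  by exists 0%N; rewrite expr0 mulr1 -exprnP rpredM ?rpredX ?intr_int.
(* [Negz n] stands for -(n + 1), whence the exponent n + 1. *)
by exists n.+1; rewrite NegzE -exprnN mulfVK ?expf_neq0 ?intr_int.
Qed.

(** Each coefficient has its own exponent; their maximum serves all of them, since surplus powers of
    [b] are integers. *)
Lemma polyOver_bdecimal_scale (b : int) (Q : {poly rat}) : b != 0 ->
  Q \is a polyOver (bdecimal b) ->
  exists n : nat, b%:~R ^+ n *: Q \is a polyOver Num.int.
Proof.
move=> b0; rewrite qualifE /= => /(all_nthP 0) bQ.
have /choice [e eP] := fun i : 'I_(size Q) =>
  bdecimal_mulX_int _ _ b0 (bQ i (ltn_ord i)).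
exists (\max_(i < size Q) e i)%N; apply/polyOverP => i; rewrite coefZ mulrC.
(* [e] is defined only below [size Q]; from there on the coefficients are 0. *)
have [/(nth_default 0) -> | ltiQ] := leqP (size Q) i; first by rewrite mul0r.
rewrite -(subnKC (leq_bigmax (F := e) (Ordinal ltiQ))) exprD mulrA.
by rewrite rpredM ?rpredX ?intr_int // (eP (Ordinal ltiQ)).
Qed.

(** If b^n = k q, then p/q = p k b^(-n). *)
Lemma bdecimal_dvd_denq (b : int) (x : rat) (n : nat) : b != 0 ->
  (denq x %| b ^+ n)%Z -> x \in bdecimal b.
Proof.
move=> b0 /dvdzP [k kE]; apply/asboolP; exists (numq x * k), (- n%:Z).
have bq0 : b%:~R != 0 :> rat by rewrite intr_eq0.
rewrite -exprnN; apply: (canRL (mulfK _)); first exact: expf_neq0.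
by rewrite -rmorphXn kE !rmorphM /= numqE mulrAC mulrA.
Qed.

Theorem theorem9 (R : realType) :
  (forall Q : {poly int}, Q \is monic ->
     forall x : R, root (map_poly (intr : int -> R) Q) x ->
       x \is a Num.int \/ irrational x)
  /\
  (forall b : int, 1 < b ->
     forall Q : {poly rat}, Q \is a polyOver (bdecimal b) -> Q \is monic ->
     forall x : R, root (map_poly (ratr : rat -> R) Q) x ->
       (exists2 d : rat, d \in bdecimal b & x = ratr d) \/ irrational x).
Proof.
split=> [Q /monicP monQ x Qx | b b1 Q bQ /monicP monQ x Qx];
  have [[d _ dx] | irr_x] := pselect (rational x); (try by right); left;
  rewrite -{x}dx in Qx *.
- have Qd : root (map_poly intr Q) d.
    (* The root descends from [R] to [rat] because [ratr] is an injective ring morphism. *)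
    rewrite -(fmorph_root (ratr : rat -> R)) -map_poly_comp.
    by rewrite (eq_map_poly (g := intr)) // => z; rewrite /= ratr_int.
  have := dvd_denq_lead_coef _ _ Qd.
  rewrite monQ dvdz1 -eqz_nat absz_denq => /eqP d1.
  by rewrite -[d]divq_num_den d1 divr1 ratr_int intr_int.
- exists d => //; rewrite fmorph_root in Qx.
  have b0 : b != 0 by rewrite gt_eqF // (lt_trans _ b1).
  (* [P] is b^n Q with its coefficients read as integers. *)
  have [n /floorpP [P PE]] := polyOver_bdecimal_scale _ _ b0 bQ.
  have Pd : root (map_poly intr P) d.
    by rewrite -PE /root hornerZ (rootP Qx) mulr0.
  have leadP : lead_coef P = b ^+ n.
    apply: (@intr_inj rat); rewrite -lead_coef_map_inj ?rmorph0 //; last first.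
      exact: intr_inj.
    by rewrite -PE lead_coefZ monQ mulr1 rmorphXn.
  by apply: (bdecimal_dvd_denq _ _ n b0); rewrite -leadP dvd_denq_lead_coef.
Qed.
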